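(* For every integer $N\ge1$, the following identity of polynomials in $t,x_1,x_2$ holds: $$\sum_{i_{1}=0}^{2^{N}-1}\sum_{i_{2}=0}^{2^{N}-1}(-1)^{s_{2}(i_{1}+i_{2})}(t+i_{1}x_{1}+i_{2}x_{2})^{N}=(-1)^{N}N!\,2^{\frac{N(N-1)}{2}}\left(2\,\frac{x_{1}^{N}-x_{2}^{N}}{x_{1}-x_{2}}\,t+2^{N}\,\frac{x_{1}^{N+1}-x_{2}^{N+1}}{x_{1}-x_{2}}+x_{1}x_{2}(2^{N}-1)\frac{x_{1}^{N-1}-x_{2}^{N-1}}{x_{1}-x_{2}}\right).$$
   Context: For a nonnegative integer $n$, $s_2(n)$ denotes the sum of the binary digits of $n$. The quotients $\frac{x_1^k-x_2^k}{x_1-x_2}$ are understood as polynomials in $x_1,x_2$ (equal to $0$ for $k=0$). The left-hand side is the polynomial denoted $H_{2,N}(t,\mathbf{x})$ in the paper, $\mathbf{x}=(x_1,x_2)$. *)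

(* Defs.v *)
From HB Require Import structures.
From mathcomp Require Import all_boot all_order all_algebra.
From mathcomp Require Export mpoly.

Set Implicit Arguments.
Unset Strict Implicit.
Unset Printing Implicit Defensive.

Import GRing.Theory.
Local Open Scope ring_scope.

(* Binary digit sum; the bits of n of index i >= n vanish, since n < 2 ^ n. *)
Definition s2 (n : nat) : nat := (\sum_(i < n) (n %/ 2 ^ i) %% 2)%N.

Definition t : {mpoly int[3]} := 'X_(@Ordinal 3 0 isT).
Definition x1 : {mpoly int[3]} := 'X_(@Ordinal 3 1 isT).
Definition x2 : {mpoly int[3]} := 'X_(@Ordinal 3 2 isT).

Lemma quot_exists (k : nat) :
  exists q : {mpoly int[3]}, q * (x1 - x2) == x1 ^+ k - x2 ^+ k.
Proof.
exists (\sum_(i < k) x1 ^+ (k.-1 - i) * x2 ^+ i).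
by rewrite subrXX mulrC.
Qed.

(* (x1 ^ k - x2 ^ k) / (x1 - x2) as an exact quotient of polynomials: the
   polynomial q such that q * (x1 - x2) = x1 ^ k - x2 ^ k, which is unique
   because x1 - x2 is a nonzero element of an integral domain. *)
Definition quot (k : nat) : {mpoly int[3]} := xchoose (quot_exists k).

Lemma quotP (k : nat) : quot k * (x1 - x2) = x1 ^+ k - x2 ^+ k.
Proof. exact/eqP/(xchooseP (quot_exists k)). Qed.

Lemma x1Bx2_neq0 : x1 - x2 != 0.
Proof.
rewrite subr_eq0; apply/eqP => /(congr1 (mcoeff U_(@Ordinal 3 1 isT))).
by rewrite !mcoeffXU.
Qed.

Lemma quot_uniq (k : nat) (q : {mpoly int[3]}) :
  q * (x1 - x2) = x1 ^+ k - x2 ^+ k -> q = quot k.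
Proof. by rewrite -quotP => /(mulIf x1Bx2_neq0). Qed.

Lemma quot0 : quot 0 = 0.
Proof. by apply/esym/quot_uniq; rewrite mul0r !expr0 subrr. Qed.

(* Main.v *)
Require Import Defs.
From mathcomp Require Import all_boot all_order all_algebra.
From mathcomp Require Import ring zify.
Set Implicit Arguments.
Unset Strict Implicit.
Unset Printing Implicit Defensive.

Import GRing.Theory.
Local Open Scope ring_scope.

(** The Thue-Morse sign a(n) = (-1) ^ s2(n) satisfies a(2m) = a(m) and
    a(2m+1) = - a(m).  Splitting both indices of the sum by parity, the
    summands with i1 and i2 both odd carry the sign a(2(m+1)) = a(m+1), with m
    the sum of the two halves: a carry occurs, and the sums weighted by a alone
    do not form a closed system.  The sums weighted by a and by its forward
    difference d(m) = a(m+1) - a(m) do.  Let E_c be the shift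
    p(X) |-> p(X + c) and let S_N(x, y), Q_N(x, y) be the operators
    p |-> sum_{i, j < 2^N} w(i+j) p(X + i x + j y) for w = a, d.  Then
      S_{N+1}(x, y) =    S_N(2x, 2y) (1-E_x)(1-E_y) + Q_N(2x, 2y) E_{x+y},
      Q_{N+1}(x, y) = -2 S_N(2x, 2y) (1-E_x)(1-E_y)
                      + Q_N(2x, 2y) (E_x + E_y - 2 E_{x+y})
    ([grid_sum_tm_rec], [grid_sum_dtm_rec]).

    In terms of the derivation D, the operator (1-E_x)(1-E_y) starts with
    xy D^2 and E_x + E_y - 2 E_{x+y} starts with -(x+y) D.  By induction S_N
    starts in order D^(N-1) and Q_N in order D^N.  Applied to X^N, the operator
    S_N therefore leaves only its coefficients of D^(N-1) and D^N, which give
    the part of the identity linear in t and the part constant in t.  The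
    recursion determines the two leading coefficients of S_N and of Q_N from
    those of S_{N-1} and Q_{N-1}; with h_k = (x^k - y^k) / (x - y) and
    c_N = (-1)^N 2^(N(N-1)/2) they are
      S_N : 2 c_N h_N,         c_N (2^N h_{N+1} + xy (2^N-1) h_{N-1}),
      Q_N : - 2 c_N h_{N+1},   - c_N (2^N-1) (x+y) h_{N+1}
    ([grid_sum_tm_dtm]).  The induction step is an identity that follows from
    h_{k+2} = (x+y) h_{k+1} - xy h_k and from the homogeneity of h_k, which
    absorbs the doubling of x and y.

    The lead terms are stated as exact formulas on polynomials of bounded
    degree.  Everything then holds in any commutative ring: the factor 1/2
    of second-order Taylor terms only occurs multiplied by an even
    coefficient. *)

(** * Binary digits *)

(** The number of digits summed in [s2 n] depends on [n]; a common bound makes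
    the sums for different arguments comparable. *)
Lemma s2_widen (n k : nat) :
  (n <= k)%N -> s2 n = (\sum_(0 <= i < k) (n %/ 2 ^ i) %% 2)%N.
Proof.
move=> le_nk; rewrite (big_cat_nat (leq0n n) le_nk) //= big_mkord [X in (_ + X)%N]big_nat.
rewrite [X in (_ + X)%N]big1 ?addn0 // => i /andP[le_ni _].
have lt_n : (n < 2 ^ i)%N by apply: leq_ltn_trans le_ni (ltn_expl i _).
by rewrite (divn_small lt_n).
Qed.

Lemma s2_bit (b : bool) (m : nat) : s2 (b + m.*2) = (b + s2 m)%N.
Proof.
have b_half : ((b + m.*2) %/ 2 = m)%N by rewrite divn2 half_bit_double.
have le_bm : (b + m.*2 <= m.*2.+2)%N by case: b {b_half}; lia.
have le_m : (m <= m.*2.+1)%N by lia.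
rewrite (s2_widen le_bm) (s2_widen le_m).
rewrite big_nat_recl // divn1 modn2 oddD odd_double addbF oddb; congr (_ + _)%N.
by apply: eq_bigr => i _; rewrite expnS divnMA b_half.
Qed.

(** * Shifts and differences of polynomials *)

Section GridSums.

Variable R : comNzRingType.
Implicit Types (p q : {poly R}) (x y c t : R) (w : nat -> R) (n N : nat).

Definition shift c p := p \Po ('X + c%:P).
Definition diff c p := shift c p - p.

Lemma horner_shift c p t : (shift c p).[t] = p.[t + c].
Proof. by rewrite horner_comp !hornerE. Qed.

Lemma horner_diff c p t : (diff c p).[t] = p.[t + c] - p.[t].
Proof. by rewrite hornerD hornerN horner_shift. Qed.

Lemma derivn_shift c p n : (shift c p)^`(n) = shift c p^`(n).
Proof.
elim: n => // n IHn; rewrite !derivnS IHn deriv_comp.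
by rewrite derivD derivX derivC addr0 mulr1.
Qed.

Lemma derivn_diff c p n : (diff c p)^`(n) = diff c p^`(n).
Proof. by rewrite derivnB derivn_shift. Qed.

Lemma size_shift c p : (size (shift c p) <= size p)%N.
Proof.
have [->|p_neq0] := eqVneq p 0; first by rewrite /shift comp_poly0 size_poly0.
apply: leq_trans (size_comp_poly_leq _ _) _.
by rewrite size_XaddC muln1 prednK // lt0n size_poly_eq0.
Qed.

(** A difference lowers the degree. The induction rests on
    (E_c - 1)(pX + a) = ((E_c - 1) p) X + c E_c p. *)
Lemma size_diff c p n : (size p <= n.+1)%N -> (size (diff c p) <= n)%N.
Proof.
elim/poly_ind: p n => [|p a IHp] n.
  by rewrite /diff /shift comp_poly0 subrr size_poly0.
have ->: diff c (p * 'X + a%:P) = diff c p * 'X + shift c p * c%:P.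
  by rewrite /diff /shift comp_poly_MXaddC; ring.
have [-> _|p_neq0] := eqVneq p 0.
  by rewrite /diff /shift comp_poly0 subrr !mul0r addr0 size_poly0.
rewrite size_MXaddC (negPf p_neq0) /= ltnS.
case: n => [|n] size_p; first by rewrite leqn0 size_poly_eq0 (negPf p_neq0) in size_p.
apply: leq_trans (size_polyD _ _) _; rewrite geq_max; apply/andP; split.
  apply: leq_trans (size_polyMleq _ _) _.
  by rewrite size_polyX addn2 /= ltnS IHp.
rewrite mulrC mul_polyC; apply: leq_trans (size_scale_leq _ _) _.
exact: leq_trans (size_shift _ _) _.
Qed.

Lemma size_derivn p n : (size p^`(n) <= size p - n)%N.
Proof.
apply/leq_sizeP => i; rewrite leq_subLR => le_i.
by rewrite coef_derivn nth_default ?mul0rn.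
Qed.

Lemma taylor2 p t c : (size p <= 2)%N -> p.[t + c] = p.[t] + c * p^`().[t].
Proof.
move=> size_p; rewrite (nderiv_taylor_wide (mulrC _ _) size_p).
by rewrite !big_ord_recl big_ord0 /= nderivn0 nderivn1 /bump /=; ring.
Qed.

Lemma taylor4 p t c : (size p <= 4)%N ->
  p.[t + c] = p.[t] + c * p^`().[t] + c ^+ 2 * p^`N(2).[t] + c ^+ 3 * p^`N(3).[t].
Proof.
move=> size_p; rewrite (nderiv_taylor_wide (mulrC _ _) size_p).
by rewrite !big_ord_recl big_ord0 /= nderivn0 nderivn1 /bump /=; ring.
Qed.

Lemma horner_derivn2 p t : p^`(2).[t] = 2%:R * p^`N(2).[t].
Proof. by rewrite nderivn_def hornerMn -mulr_natl. Qed.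

Lemma horner_derivn3 p t : p^`(3).[t] = 6%:R * p^`N(3).[t].
Proof. by rewrite nderivn_def hornerMn -mulr_natl. Qed.

(** The operator (1 - E_x)(1 - E_y) of the recursion. *)
Definition mixed_diff x y p := diff y (diff x p).

(** The operator E_x + E_y - 2 E_{x+y} of the recursion, in a form that shows
    that it lowers the degree: -(E_y - 1) E_x - (E_x - 1) E_y. *)
Definition carry_diff x y p := - (diff y (shift x p) + diff x (shift y p)).

Lemma horner_mixed_diff x y p t :
  (mixed_diff x y p).[t] = p.[t] - p.[t + x] - p.[t + y] + p.[t + x + y].
Proof. by rewrite !horner_diff [t + y + x]addrAC; ring. Qed.

Lemma horner_carry_diff x y p t :
  (carry_diff x y p).[t] = p.[t + x] + p.[t + y] - 2%:R * p.[t + x + y].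
Proof.
rewrite hornerN hornerD !horner_diff !horner_shift [t + y + x]addrAC; ring.
Qed.

(** On degree at most 2 the next term xy(x+y)/2 D^3 of the expansion vanishes;
    on degree at most 3 it is the last one, and doubling clears its
    denominator. *)
Lemma mixed_diff_lead x y p t : (size p <= 3)%N ->
  (mixed_diff x y p).[t] = x * y * p^`(2).[t].
Proof.
move=> size_p; rewrite horner_mixed_diff -!(addrA t) !taylor4 1?leqW //.
rewrite (nderivn_poly0 size_p) horner0 horner_derivn2; ring.
Qed.

Lemma mixed_diff_lead2 x y p t : (size p <= 4)%N ->
  2%:R * (mixed_diff x y p).[t] =
  2%:R * (x * y) * p^`(2).[t] + x * y * (x + y) * p^`(3).[t].
Proof.
move=> size_p; rewrite horner_mixed_diff -!(addrA t) !taylor4 //.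
rewrite horner_derivn2 horner_derivn3; ring.
Qed.

(** The expansion begins -(x+y) D - ((x^2+y^2)/2 + 2xy) D^2; as above, it is
    doubled as soon as the second term matters. *)
Lemma carry_diff_lead x y p t : (size p <= 2)%N ->
  (carry_diff x y p).[t] = - (x + y) * p^`().[t].
Proof.
by move=> size_p; rewrite horner_carry_diff -!(addrA t) !taylor2 //; ring.
Qed.

Lemma carry_diff_lead2 x y p t : (size p <= 3)%N ->
  2%:R * (carry_diff x y p).[t] =
  - (2%:R * (x + y) * p^`().[t] + (x ^+ 2 + y ^+ 2 + 4%:R * (x * y)) * p^`(2).[t]).
Proof.
move=> size_p; rewrite horner_carry_diff -!(addrA t) !taylor4 1?leqW //.
rewrite (nderivn_poly0 size_p) horner0 horner_derivn2; ring.
Qed.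

Lemma size_mixed_diff x y p n :
  (size p <= n.+2)%N -> (size (mixed_diff x y p) <= n)%N.
Proof. by move=> size_p; do 2!apply: size_diff. Qed.

Lemma size_carry_diff x y p n :
  (size p <= n.+1)%N -> (size (carry_diff x y p) <= n)%N.
Proof.
move=> size_p; rewrite size_polyN.
apply: leq_trans (size_polyD _ _) _; rewrite geq_max; apply/andP.
by split; apply/size_diff/(leq_trans (size_shift _ _)).
Qed.

Lemma derivn_mixed_diff x y p n : (mixed_diff x y p)^`(n) = mixed_diff x y p^`(n).
Proof. by rewrite !derivn_diff. Qed.

Lemma derivn_carry_diff x y p n : (carry_diff x y p)^`(n) = carry_diff x y p^`(n).
Proof. by rewrite derivnN derivnD !derivn_diff !derivn_shift. Qed.

(** * Sums over the grid and their recursions *)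

Lemma sum_nat_double (V : nmodType) (F : nat -> V) (n : nat) :
  \sum_(0 <= i < n.*2) F i = \sum_(0 <= i < n) (F i.*2 + F i.*2.+1).
Proof.
elim: n => [|n IHn]; first by rewrite !big_geq.
by rewrite doubleS !big_nat_recr //= IHn addrA.
Qed.

Definition grid_sum w N x y p t : R :=
  \sum_(0 <= i < 2 ^ N) \sum_(0 <= j < 2 ^ N)
    w (i + j)%N * p.[t + i%:R * x + j%:R * y].

Lemma grid_sumZ c w N x y p t :
  grid_sum (fun m => c * w m) N x y p t = c * grid_sum w N x y p t.
Proof.
rewrite mulr_sumr; apply: eq_bigr => i _; rewrite mulr_sumr.
by apply: eq_bigr => j _; rewrite mulrA.
Qed.

(** The four parity classes of (i, j): the parities of i and j shift the
    evaluation point, and their sum shifts the argument of the weight. *)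
Lemma grid_sum_rec w N x y p t :
  grid_sum w N.+1 x y p t =
  let S k := grid_sum (fun m => w (m.*2 + k)%N) N (2%:R * x) (2%:R * y) p in
  S 0%N t + S 1%N (t + y) + (S 1%N (t + x) + S 2%N (t + x + y)).
Proof.
rewrite /grid_sum expnS mul2n sum_nat_double -!big_split /=.
apply: eq_bigr => i _; rewrite !sum_nat_double -!big_split /=.
apply: eq_bigr => j _.
by congr (w _ * _.[_] + w _ * _.[_] + (w _ * _.[_] + w _ * _.[_]));
  solve [lia | rewrite -?mul2n ?mulrSr ?natrM; ring].
Qed.

(** The Thue-Morse sequence, with signs as values. *)
Definition tm (n : nat) : R := (-1) ^+ s2 n.
Definition dtm (n : nat) : R := tm n.+1 - tm n.

Lemma tm_even m : tm m.*2 = tm m.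
Proof. by rewrite /tm -[m.*2]/((false + m.*2)%N) s2_bit. Qed.

Lemma tm_odd m : tm m.*2.+1 = - tm m.
Proof. by rewrite /tm -[m.*2.+1]/((true + m.*2)%N) s2_bit exprS mulN1r. Qed.

(** From the weights a(2m) = a(m), a(2m+1) = -a(m), a(2m+2) = a(m) + d(m): the
    terms in a(m) make up the mixed difference and d(m) remains at the
    corner where both indices are odd. *)
Lemma grid_sum_tm_rec N x y p t :
  grid_sum tm N.+1 x y p t =
    grid_sum tm N (2%:R * x) (2%:R * y) (mixed_diff x y p) t
  + grid_sum dtm N (2%:R * x) (2%:R * y) p (t + x + y).
Proof.
rewrite grid_sum_rec /= /grid_sum -!big_split /=; apply: eq_bigr => i _.
rewrite -!big_split /=; apply: eq_bigr => j _; rewrite !horner_mixed_diff.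
rewrite !addn2 !addn1 addn0 -doubleS /dtm tm_odd !tm_even.
set u := i%:R * _; set v := j%:R * _.
rewrite !(addrAC _ v) !(addrAC _ u); ring.
Qed.

(** From the weights d(2m) = -2a(m), d(2m+1) = 2a(m) + d(m) and
    d(2m+2) = -2a(m) - 2d(m). *)
Lemma grid_sum_dtm_rec N x y p t :
  grid_sum dtm N.+1 x y p t =
    - 2%:R * grid_sum tm N (2%:R * x) (2%:R * y) (mixed_diff x y p) t
  + grid_sum dtm N (2%:R * x) (2%:R * y) (carry_diff x y p) t.
Proof.
rewrite -grid_sumZ grid_sum_rec /= /grid_sum -!big_split /=; apply: eq_bigr => i _.
rewrite -!big_split /=; apply: eq_bigr => j _.
rewrite !horner_mixed_diff !horner_carry_diff.
rewrite !addn2 !addn1 addn0 /dtm -doubleS !tm_odd !tm_even.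
set u := i%:R * _; set v := j%:R * _.
rewrite !(addrAC _ v) !(addrAC _ u); ring.
Qed.

(** * The two leading coefficients *)

(** The complete homogeneous polynomial of degree n - 1 in x and y, that is,
    (x^n - y^n) / (x - y). *)
Definition geom x y n : R := \sum_(i < n) x ^+ (n.-1 - i) * y ^+ i.

Lemma geom0 x y : geom x y 0 = 0.
Proof. exact: big_ord0. Qed.

Lemma geomS x y n : geom x y n.+1 = x ^+ n + y * geom x y n.
Proof.
rewrite /geom big_ord_recl /= subn0 mulr1 mulr_sumr; congr (_ + _).
apply: eq_bigr => i _; rewrite /bump /= add1n exprS mulrCA.
by congr (_ * (_ ^+ _ * _)); lia.
Qed.

Lemma geomSS x y n :
  geom x y n.+2 = (x + y) * geom x y n.+1 - x * y * geom x y n.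
Proof. by rewrite [LHS]geomS [X in (x + y) * X]geomS [X in y * X]geomS exprS; ring. Qed.

Lemma geomS_double x y n :
  geom (2%:R * x) (2%:R * y) n.+1 = 2%:R ^+ n * geom x y n.+1.
Proof.
rewrite mulr_sumr; apply: eq_bigr => i _.
rewrite -[in 2%:R ^+ n](subnK (leq_ord i)) exprD !exprMn /=; ring.
Qed.

(** Homogeneity of degree n - 1, written so as to remain true for n = 0. *)
Lemma geom_double x y n :
  2%:R * geom (2%:R * x) (2%:R * y) n = 2%:R ^+ n * geom x y n.
Proof.
by case: n => [|n]; [rewrite !geom0 !mulr0 | rewrite geomS_double mulrA -exprS].
Qed.

Definition coef N : R := (-1) ^+ N * 2%:R ^+ 'C(N, 2).

Lemma coefS N : coef N.+1 = - coef N * 2%:R ^+ N.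
Proof. by rewrite /coef exprS binS bin1 exprD; ring. Qed.

(** The leading terms of S_N and of Q_N, applied to [p] at [t]. For N = 0 the
    default value of [N.-1] is harmless, as [geom x y 0] and 2 ^ 0 - 1 vanish. *)
Definition tm_sum_formula N x y p t : R :=
  coef N * (2%:R * geom x y N * p^`(N.-1).[t]
    + (2%:R ^+ N * geom x y N.+1 + x * y * (2%:R ^+ N - 1) * geom x y N.-1)
      * p^`(N).[t]).

Definition dtm_sum_formula N x y p t : R :=
  - coef N * geom x y N.+1
    * (2%:R * p^`(N).[t] + (2%:R ^+ N - 1) * (x + y) * p^`(N.+1).[t]).

(** In the recursion the formulas occur with doubled increments. Expressing them
    by the next coefficient c_{N+1} = - 2^N c_N absorbs the factors 2^N due to the
    doubling. *)
Lemma tm_sum_formula_double N x y p t :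
  tm_sum_formula N (2%:R * x) (2%:R * y) p t =
  - coef N.+1 * (geom x y N * p^`(N.-1).[t]
    + (2%:R ^+ N * geom x y N.+1 + x * y * (2%:R ^+ N - 1) * geom x y N.-1)
      * p^`(N).[t]).
Proof.
have geom_double_pred :
    2%:R * (2%:R * geom (2%:R * x) (2%:R * y) N.-1) = 2%:R ^+ N * geom x y N.-1.
  by case: N => [|N] /=; rewrite ?geom0 ?mulr0 // geom_double exprS mulrA.
rewrite /tm_sum_formula coefS geomS_double geom_double.
transitivity (coef N * (2%:R ^+ N * geom x y N * p^`(N.-1).[t]
    + (2%:R ^+ N * (2%:R ^+ N * geom x y N.+1) + x * y * (2%:R ^+ N - 1)
       * (2%:R * (2%:R * geom (2%:R * x) (2%:R * y) N.-1))) * p^`(N).[t])).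
  by ring.
by rewrite geom_double_pred; ring.
Qed.

Lemma dtm_sum_formula_double N x y p t :
  dtm_sum_formula N (2%:R * x) (2%:R * y) p t =
  2%:R * coef N.+1 * geom x y N.+1
    * (p^`(N).[t] + (2%:R ^+ N - 1) * (x + y) * p^`(N.+1).[t]).
Proof. by rewrite /dtm_sum_formula coefS geomS_double; ring. Qed.

(** The degree bounds are those for which the expansions stop after two terms.
    They fit the recursions: the mixed difference lowers the degree by 2, the
    carry difference by 1, and the bound for S_N is one less than that for Q_N. *)
Lemma grid_sum_tm_dtm N x y p t :
  ((size p <= N.+1)%N -> grid_sum tm N x y p t = tm_sum_formula N x y p t) /\
  ((size p <= N.+2)%N -> grid_sum dtm N x y p t = dtm_sum_formula N x y p t).
Proof.
elim: N x y p t => [|N IHN] x y p t.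
  rewrite /grid_sum !big_nat1 /tm_sum_formula /dtm_sum_formula /dtm /coef.
  rewrite /tm [s2 0]big_ord0 [s2 1]big_ord1 bin0n geomS geom0 /=.
  by split=> _; rewrite !mul0r !addr0 !expr0 ?expr1; ring.
(* The next two facts expand the mixed difference of the derivative of order
   N - 1; the factor h_N = 0 covers N = 0, where [N.-1] is not N - 1. *)
have geom_diff2 q : (size q <= N.+3)%N ->
    geom x y N * (2%:R * (mixed_diff x y q^`(N.-1)).[t]) =
    geom x y N * (2%:R * (x * y) * q^`(N.+1).[t] + x * y * (x + y) * q^`(N.+2).[t]).
  case: N {IHN} => [|N] size_q; first by rewrite geom0 !mul0r.
  rewrite mixed_diff_lead2; last first.
    by apply: leq_trans (size_derivn _ _) _; rewrite leq_subLR addnC.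
  by [].
have geom_diff q : (size q <= N.+2)%N ->
    geom x y N * (mixed_diff x y q^`(N.-1)).[t] = geom x y N * (x * y * q^`(N.+1).[t]).
  case: N {IHN geom_diff2} => [|N] size_q; first by rewrite geom0 !mul0r.
  rewrite mixed_diff_lead //.
  by apply: leq_trans (size_derivn _ _) _; rewrite leq_subLR addnC.
have size_derivn_le q n k : (size q <= n + k)%N -> (size q^`(n) <= k)%N.
  by move=> size_q; apply: leq_trans (size_derivn _ _) _; rewrite leq_subLR.
have geom_pred : x * y * (2%:R ^+ N - 1) * geom x y N.-1 =
    (2%:R ^+ N - 1) * ((x + y) * geom x y N - geom x y N.+1).
  by case: N {IHN geom_diff geom_diff2} => [|N]; rewrite ?geomSS /=; ring.
split=> size_p.
  rewrite grid_sum_tm_rec (proj1 (IHN _ _ _ _)) ?size_mixed_diff 1?leqW //.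
  rewrite (proj2 (IHN _ _ _ _)) // tm_sum_formula_double dtm_sum_formula_double.
  rewrite !derivn_mixed_diff geom_diff //.
  rewrite (@mixed_diff_lead _ _ p^`(N)); last by apply: size_derivn_le; lia.
  rewrite -(addrA t) !taylor2 -?derivnS; try by apply: size_derivn_le; lia.
  rewrite -[_^`(2)]/(p^`(N.+2)) (derivn_poly0 size_p) horner0.
  rewrite /tm_sum_formula geomSS exprS; ring.
rewrite grid_sum_dtm_rec (proj1 (IHN _ _ _ _)) ?size_mixed_diff //.
rewrite (proj2 (IHN _ _ _ _)) ?size_carry_diff //.
rewrite tm_sum_formula_double dtm_sum_formula_double.
rewrite !derivn_mixed_diff !derivn_carry_diff geom_pred.
rewrite (@carry_diff_lead _ _ p^`(N.+1)); last by apply: size_derivn_le; lia.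
(* The differences are paired with a factor 2: two of them need their second
   order term, whose coefficient is an integer only after doubling. *)
transitivity (coef N.+1 *
  (geom x y N * (2%:R * (mixed_diff x y p^`(N.-1)).[t])
   + (2%:R ^+ N * geom x y N.+1
      + (2%:R ^+ N - 1) * ((x + y) * geom x y N - geom x y N.+1))
     * (2%:R * (mixed_diff x y p^`(N)).[t])
   + geom x y N.+1 * (2%:R * (carry_diff x y p^`(N)).[t])
   - 2%:R * (2%:R ^+ N - 1) * (x + y) ^+ 2 * geom x y N.+1 * p^`(N.+2).[t])).
  by rewrite -derivnS; ring.
have size_pN : (size p^`(N) <= 3)%N by apply: size_derivn_le; lia.
rewrite geom_diff2 // carry_diff_lead2 // mixed_diff_lead //.
rewrite -[_^`(2)]/(p^`(N.+2)) -derivnS /dtm_sum_formula geomSS (exprS _ N); ring.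
Qed.

Lemma grid_sum_tm_exp N x y t : (0 < N)%N ->
  grid_sum tm N x y 'X^N t =
  coef N * N`!%:R * (2%:R * geom x y N * t + 2%:R ^+ N * geom x y N.+1
    + x * y * (2%:R ^+ N - 1) * geom x y N.-1).
Proof.
case: N => // N _; rewrite (proj1 (grid_sum_tm_dtm _ _ _ _ _)) ?size_polyXn //.
rewrite /tm_sum_formula succnK !derivnXn subnn subSnn ffactnn expr0 expr1.
have -> : (N.+1 ^_ N = N.+1`!)%N.
  by rewrite -(ffact_fact (leqnSn N)) subSnn muln1.
by rewrite !hornerMn hornerX hornerC -(mulr_natr t); ring.
Qed.

End GridSums.

Lemma quotE k : quot k = geom x1 x2 k.
Proof. by apply/esym/quot_uniq; rewrite mulrC -subrXX. Qed.

Theorem theorem14 (N : nat) (hN : (1 <= N)%N) :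
  \sum_(0 <= i1 < 2 ^ N) \sum_(0 <= i2 < 2 ^ N)
     (-1) ^+ s2 (i1 + i2) * (t + i1%:R * x1 + i2%:R * x2) ^+ N
  = (-1) ^+ N * N`!%:R * 2%:R ^+ (N * (N - 1) %/ 2)
    * (2%:R * quot N * t + 2%:R ^+ N * quot (N + 1)
       + x1 * x2 * (2%:R ^+ N - 1) * quot (N - 1)).
Proof.
transitivity (grid_sum (@tm _) N x1 x2 'X^N t).
  by apply: eq_bigr => i _; apply: eq_bigr => j _; rewrite hornerXn.
rewrite (grid_sum_tm_exp _ _ _ hN) /coef bin2 divn2 addn1 subn1 !quotE.
by congr (_ * _); exact: mulrAC.
Qed.
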